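(* Let $L$ be an upper well ordered chain and let $\mu$ be a normal $L$-subgroup of $G$. Then $\Phi(\mu)$ is a normal $L$-subgroup of $\mu$.
   Context: $L$ is a completely distributive (complete) lattice with least element $0$ and greatest element $1$; $G$ is a group. A chain $L$ is upper well ordered if every non-empty subset of $L$ contains its supremum. An $L$-subset of $G$ is a function $G\to L$; $\eta\subseteq\mu$ means $\eta(x)\le\mu(x)$ for all $x\in G$; intersections of $L$-subsets are pointwise meets. An $L$-subset $\mu$ of $G$ is an $L$-subgroup of $G$ if $\mu(xy)\ge\mu(x)\wedge\mu(y)$ and $\mu(x^{-1})=\mu(x)$ for all $x,y\in G$; it is a normal $L$-subgroup of $G$ if moreover $\mu(xy)=\mu(yx)$ for all $x,y\in G$. $L(\mu)$ is the set of $L$-subgroups $\eta$ of $G$ with $\eta\subseteq\mu$ (called $L$-subgroups of $\mu$). An $\eta\in L(\mu)$ is a normal $L$-subgroup of $\mu$ if $\eta(yxy^{-1})\ge\eta(x)\wedge\mu(y)$ for all $x,y\in G$. An $\eta\in L(\mu)$ is proper if $\eta$ is non-constant and $\eta\neq\mu$. A proper $L$-subgroup $\eta$ of $\mu$ is a maximal $L$-subgroup of $\mu$ if whenever $\eta\subseteq\theta\subseteq\mu$ with $\theta\in L(\mu)$, then $\theta=\eta$ or $\theta=\mu$. The Frattini $L$-subgroup $\Phi(\mu)$ is the intersection of all maximal $L$-subgroups of $\mu$, with $\Phi(\mu)=\mu$ if $\mu$ has no maximal $L$-subgroups. *)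

(* Defs.v *)
From HB Require Import structures.
From mathcomp Require Import all_boot all_order.
From mathcomp Require Import boolp classical_sets.

Set Implicit Arguments.
Unset Strict Implicit.
Unset Printing Implicit Defensive.

Local Open Scope classical_set_scope.
Local Open Scope order_scope.
Local Open Scope group_scope.

Section CompleteLattices.
Context {d : Order.disp_t} {L : tbLatticeType d}.

Definition complete : Prop :=
  forall A : set L, supremums A !=set0 /\ infimums A !=set0.

(* When L is complete these are the actual supremum and infimum of every A:
   the first argument of supremum (infimum) is its value on the empty set. *)
Definition Sup (A : set L) : L := supremum \bot A.
Definition Inf (A : set L) : L := infimum \top A.

Definition completely_distributive : Prop :=
  complete /\
  forall (I : Type) (J : I -> Type) (a : forall i : I, J i -> L),
    Inf (range (fun i : I => Sup (range (a i)))) =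
    Sup (range (fun f : forall i : I, J i =>
      Inf (range (fun i : I => a i (f i))))).

Definition upper_well_ordered : Prop :=
  forall A : set L, A !=set0 -> A (Sup A).

End CompleteLattices.

Arguments complete {d} L.
Arguments completely_distributive {d} L.
Arguments upper_well_ordered {d} L.

(* L-subsets of G are functions G -> L; eta <= mu below is the pointwise order
   on functions (see boolp.lefP), and equality is equality of functions. *)
Section LSubgroups.
Context {d : Order.disp_t} {L : tbLatticeType d} {G : groupType}.
Implicit Types mu eta theta : G -> L.

Definition Lbigcap (F : set (G -> L)) : G -> L :=
  fun x => Inf [set eta x | eta in F].

Definition Lsubgroup mu : Prop :=
  (forall x y : G, Order.meet (mu x) (mu y) <= mu (x * y)) /\
  (forall x : G, mu x^-1 = mu x).

Definition normal_Lsubgroup mu : Prop :=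
  Lsubgroup mu /\ forall x y : G, mu (x * y) = mu (y * x).

Definition Lsubgroup_of mu eta : Prop := Lsubgroup eta /\ eta <= mu.

Definition normal_Lsubgroup_of mu eta : Prop :=
  Lsubgroup_of mu eta /\
  forall x y : G, Order.meet (eta x) (mu y) <= eta (y * x * y^-1).

Definition proper_Lsubgroup_of mu eta : Prop :=
  [/\ Lsubgroup_of mu eta, ~ (exists a : L, forall x : G, eta x = a)
    & eta <> mu].

Definition maximal_Lsubgroup_of mu eta : Prop :=
  proper_Lsubgroup_of mu eta /\
  forall theta, Lsubgroup_of mu theta -> eta <= theta -> theta <= mu ->
    theta = eta \/ theta = mu.

Definition Frattini mu : G -> L :=
  if `[< exists eta, maximal_Lsubgroup_of mu eta >]
  then Lbigcap [set eta | maximal_Lsubgroup_of mu eta]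
  else mu.

End LSubgroups.

(* Main.v *)
(* For every g in G, conjugation eta |-> (x |-> eta (x ^ g)) fixes mu, because
   mu is normal in G, and so it permutes the maximal L-subgroups of mu. Their
   intersection is therefore invariant under conjugation by all of G, which is
   stronger than being normal in mu. *)
Require Import Defs.
From HB Require Import structures.
From mathcomp Require Import all_boot all_order.
From mathcomp Require Import boolp classical_sets.

Set Implicit Arguments.
Unset Strict Implicit.
Unset Printing Implicit Defensive.

Import Order.TTheory.

Local Open Scope classical_set_scope.
Local Open Scope order_scope.
Local Open Scope group_scope.

Section Infima.
Context {d : Order.disp_t} {L : tbLatticeType d}.
Hypothesis Lcomplete : complete L.

Lemma Inf_le (A : set L) a : A a -> Inf A <= a.
Proof.
(* [infimum] returns the default [\top] on the empty set, and otherwise a chosen member of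
   [infimums A], which [Lcomplete] makes inhabited. *)
move=> Aa; rewrite /Inf /infimum; case: ifPn => [/eqP A0|_].
  by move: Aa; rewrite A0.
have [_ [m mA]] := Lcomplete A.
by case: xgetP => [y _ [lbA _]|/(_ m)//]; apply: lbA.
Qed.

Lemma le_Inf (A : set L) b : (forall a, A a -> b <= a) -> b <= Inf A.
Proof.
move=> bA; rewrite /Inf /infimum; case: ifPn => [_|_]; first exact: lex1.
have [_ [m mA]] := Lcomplete A.
by case: xgetP => [y _ [_]|/(_ m)//]; apply.
Qed.

End Infima.

Section Frattini.
Context {d : Order.disp_t} {L : tbLatticeType d} {G : groupType}.
Implicit Types (mu eta theta : G -> L) (F : set (G -> L)).

(** On the indicator of a subgroup H this gives the indicator of g H g^-1. *)
Definition conjL (g : G) eta : G -> L := fun x => eta (x ^ g).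

Lemma conjLK g : cancel (conjL g) (conjL g^-1).
Proof. by move=> eta; apply/funext => x; rewrite /conjL conjgKV. Qed.

Lemma conjLVK g : cancel (conjL g^-1) (conjL g).
Proof. by move=> eta; apply/funext => x; rewrite /conjL conjgK. Qed.

Lemma le_conjL g eta theta : eta <= theta -> conjL g eta <= conjL g theta.
Proof. by move=> /lefP le_et; apply/lefP => x; apply: le_et. Qed.

Lemma Lsubgroup_conjL g eta : Lsubgroup eta -> Lsubgroup (conjL g eta).
Proof.
by case=> etaM etaV; split=> [x y|x]; rewrite /conjL ?conjMg ?conjVg.
Qed.

Lemma normal_conjL mu g : normal_Lsubgroup mu -> conjL g mu = mu.
Proof.
by case=> _ muC; apply/funext => x; rewrite /conjL conjgE muC mulgK.
Qed.

Lemma Lsubgroup_of_conjL mu g eta : normal_Lsubgroup mu ->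
  Lsubgroup_of mu eta -> Lsubgroup_of mu (conjL g eta).
Proof.
move=> /(normal_conjL g) mug [etaG le_eta_mu].
by split; [apply: Lsubgroup_conjL | rewrite -mug; apply: le_conjL].
Qed.

(** [conjL g] is an order automorphism of the L-subgroups of [mu], with inverse [conjL g^-1]. A
    [theta] between [conjL g eta] and [mu] is pulled back to lie between [eta] and [mu], where
    maximality of [eta] applies. *)
Lemma maximal_conjL mu g eta : normal_Lsubgroup mu ->
  maximal_Lsubgroup_of mu eta -> maximal_Lsubgroup_of mu (conjL g eta).
Proof.
move=> hmu [[eta_mu eta_nconst eta_neq] eta_max].
have muV := normal_conjL g^-1 hmu.
split=> [|theta theta_mu le_eta_theta le_theta_mu].
  split; first exact: Lsubgroup_of_conjL.
  (* Every [x] is a conjugate by [g], so [eta] and [conjL g eta] take the same values. *)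
  - case=> a eta_a; apply: eta_nconst; exists a => x.
    by rewrite -(conjgKV g x); apply: eta_a.
  - by move=> etag; apply: eta_neq; rewrite -[eta](conjLK g) etag.
have := eta_max (conjL g^-1 theta).
case.
- exact: Lsubgroup_of_conjL.
- by rewrite -[X in X <= _](conjLK g); apply: le_conjL.
- by rewrite -muV; apply: le_conjL.
- by move=> <-; left; rewrite conjLVK.
- by move=> thetaV; right; rewrite -[theta](conjLVK g) thetaV normal_conjL.
Qed.

Hypothesis Lcomplete : complete L.

Lemma Lbigcap_le F eta : F eta -> Lbigcap F <= eta.
Proof. by move=> Feta; apply/lefP => x; apply: Inf_le => //; exists eta. Qed.

Lemma Lsubgroup_Lbigcap F :
  (forall eta, F eta -> Lsubgroup eta) -> Lsubgroup (Lbigcap F).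
Proof.
move=> FG; split=> [x y|x].
  apply: le_Inf => // _ [eta Feta <-]; have [etaM _] := FG _ Feta.
  by apply: le_trans (etaM x y); apply: leI2; apply: (lefP _ _ (Lbigcap_le Feta)).
congr Inf; apply: eq_imagel => eta /FG[_ etaV]; exact: etaV.
Qed.

(** Each [eta (x ^ g)] is the value at [x] of [conjL g eta], again a member of [F], so it is already
    bounded below by the meet at [x]. *)
Lemma Lbigcap_conjL g F : (forall eta, F eta -> F (conjL g eta)) ->
  Lbigcap F <= conjL g (Lbigcap F).
Proof.
move=> Fg; apply/lefP => x; apply: le_Inf => // _ [eta Feta <-].
exact: (lefP _ _ (Lbigcap_le (Fg _ Feta))).
Qed.

Lemma normal_Frattini mu :
  normal_Lsubgroup mu -> normal_Lsubgroup_of mu (Frattini mu).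
Proof.
move=> hmu; have [muG _] := hmu.
rewrite /Frattini; case: asboolP => [[eta0 max_eta0]|_]; last first.
  split=> // x y.
  (* Without maximal L-subgroups the claim concerns [mu] itself, and [mu] takes the same value at
     [y * x * y^-1] as at [x]. *)
  by rewrite -{3}(normal_conjL y hmu) /conjL conjgE !mulgA mulVg mul1g mulgVK leIl.
have [[[_ le_eta0_mu] _ _] _] := max_eta0.
split.
  (* The witness [eta0] puts the intersection below [mu]; an empty intersection would be constantly
     [\top]. *)
  split; last exact: le_trans (Lbigcap_le max_eta0) le_eta0_mu.
  by apply: Lsubgroup_Lbigcap => eta [[[]]].
(* The factor [mu y] is dropped, leaving invariance under conjugation by [y^-1], since [x ^ y^-1] is
   [y * x * y^-1]. *)
move=> x y; apply: le_trans (leIl _ _) _.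
have /lefP /(_ x) := @Lbigcap_conjL y^-1 [set eta | maximal_Lsubgroup_of mu eta]
  (fun eta => maximal_conjL y^-1 hmu).
by rewrite /conjL conjgE invgK mulgA.
Qed.

End Frattini.

Theorem theorem4p9 (d : Order.disp_t) (L : tbOrderType d) (G : groupType)
    (hL : completely_distributive L) (huwo : upper_well_ordered L)
    (mu : G -> L) (hmu : normal_Lsubgroup mu) :
  normal_Lsubgroup_of mu (Frattini mu).
Proof. by have [Lcomplete _] := hL; apply: normal_Frattini. Qed.
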